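(* Let $M^2$ be a spacelike surface in $\mathbb R^4_1$ free of flat points. Then $M^2$ is minimal if and only if at each point of $M^2$ the tangent indicatrix $\chi$ is a circle.
   Context: $\mathbb R^4_1$ is the four-dimensional Minkowski space with metric $\langle\,,\rangle$ of signature $(3,1)$, with a fixed orthonormal basis $e_1,e_2,e_3,e_4$, $e_1^2=e_2^2=e_3^2=1$, $e_4^2=-1$, giving the orientation. A surface $M^2: z=z(u,v)$, $(u,v)\in\mathcal D\subset\mathbb R^2$ (smooth immersion) is spacelike if the induced metric is Riemannian. Put $E=\langle z_u,z_u\rangle$, $F=\langle z_u,z_v\rangle$, $G=\langle z_v,z_v\rangle$, $W=\sqrt{EG-F^2}$. Choose a normal frame field $\{n_1,n_2\}$ with $\langle n_1,n_1\rangle=1$, $\langle n_2,n_2\rangle=-1$, $\langle n_1,n_2\rangle=0$, such that $\{z_u,z_v,n_1,n_2\}$ is positively oriented. Put $c_{11}^k=\langle z_{uu},n_k\rangle$, $c_{12}^k=\langle z_{uv},n_k\rangle$, $c_{22}^k=\langle z_{vv},n_k\rangle$ ($k=1,2$), $$\Delta_1=c_{11}^1c_{12}^2-c_{11}^2c_{12}^1,\quad \Delta_2=c_{11}^1c_{22}^2-c_{11}^2c_{22}^1,\quad \Delta_3=c_{12}^1c_{22}^2-c_{12}^2c_{22}^1,$$ $$L=\frac{2\Delta_1}{W},\quad M=\frac{\Delta_2}{W},\quad N=\frac{2\Delta_3}{W}.$$ A point is flat if $L=M=N=0$ there. For tangents $g_i$ spanned by $\lambda_iz_u+\mu_iz_v\neq0$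 put $$\zeta_{g_1,g_2}=\frac{L\lambda_1\lambda_2+M(\lambda_1\mu_2+\mu_1\lambda_2)+N\mu_1\mu_2}{\sqrt{I(\lambda_1,\mu_1)}\sqrt{I(\lambda_2,\mu_2)}},\qquad I(\lambda,\mu)=E\lambda^2+2F\lambda\mu+G\mu^2.$$ The normal curvature of $g$ is $\nu_g=\zeta_{g,g}$; $g$ is principal if $\zeta_{g,g^\bot}=0$, where $g^\bot$ is the tangent orthogonal to $g$. At every point there are two orthogonal principal tangents; their normal curvatures $\nu',\nu''$ are the principal normal curvatures (if all tangents at $p$ are principal, $\nu'=\nu''$ is the common normal curvature and any pair of orthogonal tangents may be used). The tangent indicatrix at $p$ is the curve in $T_pM^2$ $$\chi:\ \nu'X^2+\nu''Y^2=\varepsilon,\qquad \varepsilon=\pm1,$$ in coordinates $(X,Y)$ with respect to an orthonormal basis of $T_pM^2$ along principal tangents with normal curvatures $\nu',\nu''$ (the real points of both equations $\varepsilon=1$ and $\varepsilon=-1$ are taken). $M^2$ is minimal if $H=0$ everywhere, where $H=\frac12(\sigma(x,x)+\sigma(y,y))$, $\sigma$ being the second fundamental tensor and $\{x,y\}$ an orthonormal tangent frame. *)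

(* Defs.v *)
From mathcomp Require Import all_boot all_order all_algebra.
From mathcomp Require Import ring.
From mathcomp Require Import all_classical all_reals all_analysis.

Set Implicit Arguments.
Unset Strict Implicit.
Unset Printing Implicit Defensive.

Import Order.TTheory GRing.Theory Num.Theory.
Import numFieldNormedType.Exports.

Local Open Scope classical_set_scope.
Local Open Scope ring_scope.

(* f is C^k on D: all its iterated directional derivatives of order at most k
   exist on D and are continuous there. *)
Fixpoint Ck_on (R : realType) (m n k : nat) (D : set 'rV[R]_m.+1)
    (f : 'rV[R]_m.+1 -> 'rV[R]_n.+1) : Prop :=
  if k is k'.+1 then
    (forall p, D p -> differentiable f p) /\
    (forall v, Ck_on k' D (fun p => 'D_v f p))
  else forall p, D p -> {for p, continuous f}.

Definition smooth_on (R : realType) (m n : nat) (D : set 'rV[R]_m.+1)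
    (f : 'rV[R]_m.+1 -> 'rV[R]_n.+1) : Prop :=
  forall k, Ck_on k D f.

(* The metric of signature (3,1) on R^4_1: e_4 = delta_mx 0 ord_max is the
   timelike vector of the standard basis, which also fixes the orientation. *)
Definition mink (R : realType) (x y : 'rV[R]_4) : R :=
  \sum_(i < 4) (-1) ^+ (i == ord_max) * x 0 i * y 0 i.

Section Surface.
Context {R : realType}.
Implicit Types (D : set 'rV[R]_2) (z n : 'rV[R]_2 -> 'rV[R]_4).
(* A tangent vector lambda z_u + mu z_v at z(p) is represented by the row
   (lambda, mu), i.e. by its preimage under the differential of z at p. *)
Implicit Types (p x y a b : 'rV[R]_2).

Definition du z p : 'rV[R]_4 := 'D_(delta_mx 0 0) z p.
Definition dv z p : 'rV[R]_4 := 'D_(delta_mx 0 1) z p.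

Definition zuu z := du (du z).
Definition zuv z := dv (du z).
Definition zvv z := dv (dv z).

Definition E z p := mink (du z p) (du z p).
Definition F z p := mink (du z p) (dv z p).
Definition G z p := mink (dv z p) (dv z p).
Definition W z p := Num.sqrt (E z p * G z p - F z p ^+ 2).

Definition symform (e f g : R) x y : R :=
  e * x 0 0 * y 0 0 + f * (x 0 0 * y 0 1 + x 0 1 * y 0 0) + g * x 0 1 * y 0 1.

Definition fst_form z p x y : R := symform (E z p) (F z p) (G z p) x y.

Definition spacelike_surface D z : Prop :=
  [/\ open D, smooth_on D z,
      forall p, D p -> injective ('d z p)
    & forall p x, D p -> x != 0 -> 0 < fst_form z p x x].

Definition normal_frame D z n1 n2 : Prop :=
  [/\ smooth_on D n1, smooth_on D n2
    & forall p, D p ->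
      [/\ [/\ mink (n1 p) (du z p) = 0, mink (n1 p) (dv z p) = 0,
              mink (n2 p) (du z p) = 0 & mink (n2 p) (dv z p) = 0],
          [/\ mink (n1 p) (n1 p) = 1, mink (n2 p) (n2 p) = -1
            & mink (n1 p) (n2 p) = 0]
        & 0 < \det (\matrix_(i < 4)
                      nth 0 [:: du z p; dv z p; n1 p; n2 p] i)]].

Definition c11 z n p := mink (zuu z p) (n p).
Definition c12 z n p := mink (zuv z p) (n p).
Definition c22 z n p := mink (zvv z p) (n p).

Definition Delta1 z n1 n2 p :=
  c11 z n1 p * c12 z n2 p - c11 z n2 p * c12 z n1 p.
Definition Delta2 z n1 n2 p :=
  c11 z n1 p * c22 z n2 p - c11 z n2 p * c22 z n1 p.
Definition Delta3 z n1 n2 p :=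
  c12 z n1 p * c22 z n2 p - c12 z n2 p * c22 z n1 p.

Definition L z n1 n2 p := 2 * Delta1 z n1 n2 p / W z p.
Definition M z n1 n2 p := Delta2 z n1 n2 p / W z p.
Definition N z n1 n2 p := 2 * Delta3 z n1 n2 p / W z p.

Definition flat_point z n1 n2 p : Prop :=
  [/\ L z n1 n2 p = 0, M z n1 n2 p = 0 & N z n1 n2 p = 0].

Definition zeta z n1 n2 p x y : R :=
  symform (L z n1 n2 p) (M z n1 n2 p) (N z n1 n2 p) x y
  / (Num.sqrt (fst_form z p x x) * Num.sqrt (fst_form z p y y)).

Definition normal_curvature z n1 n2 p x : R := zeta z n1 n2 p x x.

Definition principal z n1 n2 p x : Prop :=
  x != 0 /\
  forall y, y != 0 -> fst_form z p x y = 0 -> zeta z n1 n2 p x y = 0.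

Definition orthonormal z p a b : Prop :=
  [/\ fst_form z p a a = 1, fst_form z p b b = 1 & fst_form z p a b = 0].

Definition principal_frame z n1 n2 p a b : Prop :=
  [/\ orthonormal z p a b, principal z n1 n2 p a & principal z n1 n2 p b].

Definition indicatrix_eq z n1 n2 p a b (X Y : R) : Prop :=
  let q := normal_curvature z n1 n2 p a * X ^+ 2
           + normal_curvature z n1 n2 p b * Y ^+ 2 in
  q = 1 \/ q = -1.

(* The curve does not depend on the principal frame (a, b); see
   tangent_indicatrix_frame and principal_frame_exists below. *)
Definition tangent_indicatrix z n1 n2 p : set 'rV[R]_2 :=
  [set x | exists a b X Y,
     [/\ principal_frame z n1 n2 p a b, x = X *: a + Y *: b
       & indicatrix_eq z n1 n2 p a b X Y]].

(* Circles of the tangent plane, for the metric induced on it. *)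
Definition is_circle z p (S : set 'rV[R]_2) : Prop :=
  exists (c : 'rV[R]_2) (r : R), 0 < r /\
    S = [set x | Num.sqrt (fst_form z p (x - c) (x - c)) = r].

(* For a vector w of R^4_1, w - normal_part w is tangent, since n1, n2 span the
   normal plane with <n1,n1> = 1, <n2,n2> = -1, <n1,n2> = 0. *)
Definition normal_part n1 n2 p (w : 'rV[R]_4) : 'rV[R]_4 :=
  mink w (n1 p) *: n1 p - mink w (n2 p) *: n2 p.

Definition sigma z n1 n2 p x y : 'rV[R]_4 :=
  normal_part n1 n2 p
    ((x 0 0 * y 0 0) *: zuu z p
     + (x 0 0 * y 0 1 + x 0 1 * y 0 0) *: zuv z p
     + (x 0 1 * y 0 1) *: zvv z p).

Definition mean_curvature z n1 n2 p x y : 'rV[R]_4 :=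
  2^-1 *: (sigma z n1 n2 p x x + sigma z n1 n2 p y y).

(* mean_curvature is the same for all orthonormal tangent frames (x, y). *)
Definition minimal D z n1 n2 : Prop :=
  forall p x y, D p -> orthonormal z p x y ->
    mean_curvature z n1 n2 p x y = 0.

Lemma symform_span (e f g : R) a b x :
  symform e f g a a = 1 -> symform e f g b b = 1 -> symform e f g a b = 0 ->
  exists X Y, x = X *: a + Y *: b.
Proof.
move=> aa bb ab; pose d := a 0 0 * b 0 1 - a 0 1 * b 0 0.
have d0 : d != 0.
  apply/eqP => d0.
  have : (e * g - f ^+ 2) * d ^+ 2 =
      symform e f g a a * symform e f g b b - symform e f g a b ^+ 2.
    by rewrite /symform /d; ring.
  rewrite aa bb ab d0; move/eqP; rewrite !expr0n /= mulr0 mul1r subr0.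
  by rewrite eq_sym oner_eq0.
exists ((x 0 0 * b 0 1 - x 0 1 * b 0 0) / d).
exists ((a 0 0 * x 0 1 - a 0 1 * x 0 0) / d).
apply/rowP => i; rewrite !mxE.
have -> : x 0 i = d * x 0 i / d by rewrite mulrAC mulfV // mul1r.
rewrite /d in d0 *.
case: i => -[|[|//]] /= li.
  by rewrite (_ : Ordinal li = 0); [field|exact/val_inj].
by rewrite (_ : Ordinal li = 1); [field|exact/val_inj].
Qed.

Lemma symform_comb (l m n : R) a b X Y : symform l m n a b = 0 ->
  symform l m n (X *: a + Y *: b) (X *: a + Y *: b) =
  symform l m n a a * X ^+ 2 + symform l m n b b * Y ^+ 2.
Proof.
move=> ab; rewrite -[RHS]addr0 -(mulr0 (2 * X * Y)) -ab /symform !mxE; ring.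
Qed.

Lemma symform_diag (e f g l m n : R) :
  (forall x, x != 0 -> 0 < symform e f g x x) ->
  exists a b, [/\ symform e f g a a = 1, symform e f g b b = 1,
    symform e f g a b = 0 & symform l m n a b = 0].
Proof.
move=> pos.
pose mk (s t : R) : 'rV[R]_2 := \row_j if j == 0 then s else t.
have mk0 s t : mk s t 0 0 = s by rewrite mxE.
have mk1 s t : mk s t 0 1 = t by rewrite mxE.
have mkN0 s t : (s != 0) || (t != 0) -> mk s t != 0.
  apply: contraTneq => st.
  have s0 : s = 0 by rewrite -(mk0 s t) st mxE.
  have t0 : t = 0 by rewrite -(mk1 s t) st mxE.
  by rewrite s0 t0 eqxx.
have formE s t s' t' : symform e f g (mk s t) (mk s' t') =
    e * s * s' + f * (s * t' + t * s') + g * t * t'.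
  by rewrite /symform !mk0 !mk1.
have e_gt0 : 0 < e.
  have /pos : mk 1 0 != 0 by apply: mkN0; rewrite oner_neq0.
  by rewrite formE; congr (0 < _); ring.
have w_gt0 : 0 < e * g - f ^+ 2.
  have /pos : mk (- f) e != 0 by apply: mkN0; rewrite (gt_eqF e_gt0) orbT.
  rewrite formE => h; rewrite -(pmulr_rgt0 _ e_gt0).
  by move: h; congr (0 < _); ring.
have [a [b [a0 b0 ab IIab]]] : exists a b,
    [/\ a != 0, b != 0, symform e f g a b = 0 & symform l m n a b = 0].
  pose A := e * m - f * l; pose B := e * n - g * l; pose C := f * n - g * m.
  pose dlt := B ^+ 2 - 4 * A * C.
  have ok s t : (s != 0) || (t != 0) ->
      A * s ^+ 2 + B * s * t + C * t ^+ 2 = 0 ->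
      exists a b,
      [/\ a != 0, b != 0, symform e f g a b = 0 & symform l m n a b = 0].
    move=> st h; have st0 := mkN0 _ _ st.
    exists (mk s t), (mk (- (f * s + g * t)) (e * s + f * t)); split=> //.
    - apply: mkN0; rewrite oppr_eq0 -negb_and.
      apply/negP => /andP[/eqP h1 /eqP h2].
      have := pos _ st0; rewrite formE.
      suff -> : e * s * s + f * (s * t + t * s) + g * t * t = 0 by rewrite ltxx.
      transitivity (s * (e * s + f * t) + t * (f * s + g * t)); first by ring.
      by rewrite h1 h2 !mulr0 addr0.
    - by rewrite formE; ring.
    - by rewrite /symform !mk0 !mk1 -[RHS]h /A /B /C; ring.
  have [A0|A0] := eqVneq A 0.
    by apply: (ok 1 0); [rewrite oner_neq0|rewrite A0; ring].
  have dlt0 : 0 <= dlt.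
    have -> : dlt =
        ((e * B - 2 * f * A) ^+ 2 + 4 * (e * g - f ^+ 2) * A ^+ 2) / e ^+ 2.
      have e0 : e != 0 by rewrite gt_eqF.
      by rewrite /dlt /A /B /C; field.
    apply: divr_ge0; rewrite ?sqr_ge0 // addr_ge0 ?sqr_ge0 //.
    by rewrite mulr_ge0 ?sqr_ge0 // mulr_ge0 // ltW.
  apply: (ok (- B + Num.sqrt dlt) (2 * A)).
    by rewrite (mulf_neq0 _ A0) ?orbT // pnatr_eq0.
  transitivity (A * (Num.sqrt dlt ^+ 2 - dlt)); first by rewrite /dlt; ring.
  by rewrite sqr_sqrtr // subrr mulr0.
have formZ (l' m' n' : R) k h x y :
    symform l' m' n' (k *: x) (h *: y) = k * h * symform l' m' n' x y.
  by rewrite /symform !mxE; ring.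
have unit x : x != 0 -> exists k, symform e f g (k *: x) (k *: x) = 1.
  move=> /pos x0; exists (Num.sqrt (symform e f g x x))^-1.
  by rewrite formZ -expr2 exprVn sqr_sqrtr ?ltW // mulVf // gt_eqF.
have [k ka] := unit _ a0; have [h hb] := unit _ b0.
by exists (k *: a), (h *: b); split; rewrite // formZ (ab, IIab) mulr0.
Qed.

Lemma tangent_indicatrix_frame z n1 n2 p a b :
  principal_frame z n1 n2 p a b ->
  tangent_indicatrix z n1 n2 p =
  [set x | exists X Y,
     x = X *: a + Y *: b /\ indicatrix_eq z n1 n2 p a b X Y].
Proof.
have step a1 b1 X Y : principal_frame z n1 n2 p a1 b1 ->
    normal_curvature z n1 n2 p a1 * X ^+ 2 +
    normal_curvature z n1 n2 p b1 * Y ^+ 2 =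
    symform (L z n1 n2 p) (M z n1 n2 p) (N z n1 n2 p)
      (X *: a1 + Y *: b1) (X *: a1 + Y *: b1).
  case=> -[aa bb ab] [a0 pa] [b0 pb].
  have := pa _ b0 ab.
  rewrite /normal_curvature /zeta aa bb sqrtr1 mulr1 !divr1 => zab.
  by rewrite symform_comb.
move=> pf; apply/seteqP; split=> x /=.
  case=> a1 [b1 [X [Y [pf1 xE q]]]].
  have [X1 [Y1 xE1]] : exists X Y, x = X *: a + Y *: b.
    by case: pf => -[aa bb ab] _ _; apply: symform_span aa bb ab.
  exists X1, Y1; split=> //; move: q; rewrite /indicatrix_eq /=.
  by rewrite !step // -xE -xE1.
by case=> X [Y [xE q]]; exists a, b, X, Y.
Qed.

Lemma principal_frame_exists D z n1 n2 p :
  spacelike_surface D z -> D p -> exists a b, principal_frame z n1 n2 p a b.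
Proof.
case=> _ _ _ posI Dp.
have [a [b [aa bb ab IIab]]] := symform_diag (L z n1 n2 p) (M z n1 n2 p)
  (N z n1 n2 p) (fun x => posI p x Dp).
have formC (l m n : R) x y : symform l m n x y = symform l m n y x.
  by rewrite /symform; ring.
have formD (l m n : R) x X Y y y' : symform l m n x (X *: y + Y *: y') =
    X * symform l m n x y + Y * symform l m n x y'.
  by rewrite /symform !mxE; ring.
have nz x : fst_form z p x x = 1 -> x != 0.
  apply: contra_eq_neq => ->.
  have -> : fst_form z p 0 0 = 0 by rewrite /fst_form /symform !mxE; ring.
  by rewrite eq_sym oner_neq0.
exists a, b; split; first by split.
- split=> [|y _]; first exact: nz.
  have [X [Y ->]] := symform_span y aa bb ab.
  rewrite /fst_form formD aa ab mulr1 mulr0 addr0 => X0.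
  by rewrite /zeta formD X0 IIab mulr0 mul0r addr0 mul0r.
- split=> [|y _]; first exact: nz.
  have [X [Y ->]] := symform_span y aa bb ab.
  rewrite /fst_form formD bb (formC _ _ _ b a) ab mulr1 mulr0 add0r => Y0.
  by rewrite /zeta formD Y0 (formC _ _ _ b a) IIab mulr0 mul0r addr0 mul0r.
Qed.

End Surface.

(* Main.v *)
Require Import Defs.
From mathcomp Require Import all_boot all_order all_algebra.
From mathcomp Require Import ring lra.
From mathcomp Require Import all_classical all_reals all_analysis.

(** Everything happens in a single tangent plane.  Let [I] be the first
    fundamental form, [h] the second fundamental form with values in the normal
    plane, whose coordinates are the symmetric forms [h1] and [h2], and [Lambda]
    the symmetric form with coefficients L, M, N.  Writing [s ^ t] for the
    determinant of two normal vectors in the frame (n1, n2), an orthonormal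
    tangent frame (x, y) satisfies, for one common nonzero factor [k]
    (namely 1 / (W d), with [d] the determinant of the frame),

    - Lambda(x, x) = 2 k h(x, x) ^ h(x, y),
    - Lambda(y, y) = 2 k h(x, y) ^ h(y, y),
    - Lambda(x, y) = k h(x, x) ^ h(y, y)

    ([wedge_form_frame]).  Hence Lambda(x, x) = Lambda(y, y) says that the trace
    [h(x, x) + h(y, y)] is parallel to h(x, y), and Lambda(x, y) = 0 says that it
    is parallel to h(x, x).  If both hold and the point is not flat, then
    h(x, x) and h(x, y) are independent, so the trace vanishes
    ([wedges_trace0]); conversely, both hold when the trace vanishes.  So the mean
    curvature vanishes exactly when [Lambda] is a multiple of [I].

    On the other hand the tangent indicatrix is the pair of level sets
    [Lambda = 1] and [Lambda = -1] ([tangent_indicatrix_level]).  If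
    [Lambda = nu I] with [nu] nonzero, this is the circle about 0 of radius
    [1 / sqrt |nu|].  Conversely, if it is a circle, its symmetry about 0 puts
    the centre at 0, and the values of [Lambda] at a few points of the circle,
    all of them 1 or -1, force [Lambda] to be a multiple of [I]
    ([circle_level_conformal]); in particular, opposite signs of the principal
    normal curvatures give two conjugate hyperbolas, not a circle. *)

Import Order.TTheory GRing.Theory Num.Theory.
Import numFieldNormedType.Exports.

Set Implicit Arguments.
Unset Strict Implicit.
Unset Printing Implicit Defensive.

Local Open Scope classical_set_scope.
Local Open Scope ring_scope.

(** * Symmetric forms on the plane *)

Section SymmetricForms.
Context {R : realType}.
Implicit Types (x y c : 'rV[R]_2).

Lemma symformDD (l m n X Y : R) x y :
  symform l m n (X *: x + Y *: y) (X *: x + Y *: y) =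
  X ^+ 2 * symform l m n x x + 2 * X * Y * symform l m n x y
  + Y ^+ 2 * symform l m n y y.
Proof. rewrite /symform !mxE; ring. Qed.

(** The Gram determinant of an orthonormal pair is 1, which makes both the
    discriminant of the form and the determinant of the pair nonzero. *)
Lemma symform_gram (e f g : R) x y :
  symform e f g x x = 1 -> symform e f g y y = 1 -> symform e f g x y = 0 ->
  (e * g - f ^+ 2) * (x 0 0 * y 0 1 - x 0 1 * y 0 0) ^+ 2 = 1.
Proof.
move=> xx yy xy.
transitivity (symform e f g x x * symform e f g y y - symform e f g x y ^+ 2).
  by rewrite /symform; ring.
by rewrite xx yy xy; ring.
Qed.

Lemma symform_conformal (e f g l m n nu : R) x y w :
  symform e f g x x = 1 -> symform e f g y y = 1 -> symform e f g x y = 0 ->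
  symform l m n x x = nu -> symform l m n y y = nu -> symform l m n x y = 0 ->
  symform l m n w w = nu * symform e f g w w.
Proof.
move=> xx yy xy lxx lyy lxy.
have [X [Y ->]] := symform_span w xx yy xy.
by rewrite !symformDD xx yy xy lxx lyy lxy; ring.
Qed.

Lemma symform_eq0 (l m n : R) :
  (forall w, symform l m n w w = 0) -> [/\ l = 0, m = 0 & n = 0].
Proof.
move=> h.
have h0 := h (delta_mx 0 0); have h1 := h (delta_mx 0 1).
have h2 := h (delta_mx 0 0 + delta_mx 0 1).
move: h0 h1 h2; rewrite /symform !mxE /= => h0 h1 h2.
by split; lra.
Qed.

Lemma sqrtr_eq_pos (t r : R) : 0 < r -> (Num.sqrt t = r) <-> (t = r ^+ 2).
Proof.
move=> r0; split=> [tr|->]; last by rewrite sqrtr_sqr gtr0_norm.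
rewrite -tr sqr_sqrtr // leNgt; apply/negP => t0.
by move: r0; rewrite -tr ltr0_sqrtr ?ltxx.
Qed.

(** A central curve can only be a circle about 0, and on such a circle a
    quadratic form limited to the values 1 and -1 cannot vary.  By
    [symform_conformal], the conclusion makes it a multiple of the metric. *)
Lemma circle_level_conformal (e f g l m n r : R) c x y :
  (forall w, w != 0 -> 0 < symform e f g w w) -> 0 < r ->
  (forall w, (symform l m n w w = 1 \/ symform l m n w w = -1) <->
             Num.sqrt (symform e f g (w - c) (w - c)) = r) ->
  symform e f g x x = 1 -> symform e f g y y = 1 -> symform e f g x y = 0 ->
  symform l m n x x = symform l m n y y /\ symform l m n x y = 0.
Proof.
move=> pos r0 circ xx yy xy.
have oncirc w : (symform l m n w w = 1 \/ symform l m n w w = -1) <->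
    symform e f g (w - c) (w - c) = r ^+ 2.
  by rewrite -sqrtr_eq_pos.
(* Since the level curve is symmetric about 0, it contains the antipodes of the
   points c + s x, s = r or -r; adding up the two resulting equations leaves
   only the norm of c. *)
have c0 : c = 0.
  have opp s : s ^+ 2 = r ^+ 2 ->
      4 * symform e f g c c + 4 * s * symform e f g c x = 0.
    move=> s2.
    have /oncirc lev : symform e f g (c + s *: x - c) (c + s *: x - c) = r ^+ 2.
      by rewrite -s2 -[RHS]mulr1 -xx /symform !mxE; ring.
    have : symform l m n (- (c + s *: x)) (- (c + s *: x)) =
        symform l m n (c + s *: x) (c + s *: x) by rewrite /symform !mxE; ring.
    move=> levN; move: lev; rewrite -levN => /oncirc.
    have -> : symform e f g (- (c + s *: x) - c) (- (c + s *: x) - c) =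
        4 * symform e f g c c + 4 * s * symform e f g c x
        + s ^+ 2 * symform e f g x x by rewrite /symform !mxE; ring.
    by rewrite xx s2; lra.
  have o1 := opp r erefl; have o2 := opp (- r) (sqrrN r).
  by apply/eqP/negPn/negP => /pos; lra.
pose A := r ^+ 2 * symform l m n x x; pose B := r ^+ 2 * symform l m n y y.
pose C := r ^+ 2 * symform l m n x y.
have lev X Y : X ^+ 2 + Y ^+ 2 = 1 ->
    let q := X ^+ 2 * A + 2 * X * Y * C + Y ^+ 2 * B in q = 1 \/ q = -1.
  move=> XY /=.
  have -> : X ^+ 2 * A + 2 * X * Y * C + Y ^+ 2 * B =
      symform l m n ((r * X) *: x + (r * Y) *: y) ((r * X) *: x + (r * Y) *: y).
    by rewrite symformDD /A /B /C; ring.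
  apply/oncirc; rewrite c0 subr0 symformDD xx yy xy.
  by transitivity (r ^+ 2 * (X ^+ 2 + Y ^+ 2)); [ring | rewrite XY mulr1].
(* Besides the four vertices, the rational points (3/5, 4/5) and (3/5, -4/5) of
   the unit circle are enough. *)
have /= l1 := lev 1 0 ltac:(by ring).
have /= l2 := lev 0 1 ltac:(by ring).
have /= l3 := lev (3 / 5) (4 / 5) ltac:(by field).
have /= l4 := lev (3 / 5) (- (4 / 5)) ltac:(by field).
have r2 : r ^+ 2 != 0 by rewrite expf_neq0 // gt_eqF.
have [AB C0] : A = B /\ C = 0.
  by case: l1 => l1; case: l2 => l2; case: l3 => l3; case: l4 => l4; split; lra.
split; first exact: (mulfI r2).
by apply: (mulfI r2); rewrite mulr0.
Qed.

(** With [t] the squared length of a tangent vector, this says that the level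
    curve of a nonzero multiple of the metric is a circle about 0. *)
Lemma mul_eq_pm1 (nu t : R) : nu != 0 -> 0 <= t ->
  (nu * t = 1 \/ nu * t = -1) <-> t = `|nu|^-1.
Proof.
move=> nu0 t0; split=> [h|->].
  apply: (mulfI (x := `|nu|)); first by rewrite normr_eq0.
  rewrite mulfV ?normr_eq0 // -[X in _ * X](ger0_norm t0) -normrM.
  by case: h => ->; rewrite ?normrN1 ?normr1.
move: nu0; rewrite neq_lt => /orP[] nu0.
  by right; rewrite ltr0_norm // invrN mulrN mulfV // lt_eqF.
by left; rewrite gtr0_norm // mulfV // gt_eqF.
Qed.

End SymmetricForms.

(** * Wedges of two symmetric forms *)

Section Wedge.
Context {R : realType}.
Implicit Types (x y : 'rV[R]_2).

(** When [h1] and [h2] are the coordinates of the second fundamental form and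
    [w] is W, [Lam] has coefficients L, M, N.  The 2 by 2 minors that make it up
    are coordinates of the wedge of [h1] and [h2], so a change of basis to (x, y)
    brings in the determinant [d]. *)
Lemma wedge_form_frame (a1 b1 c1 a2 b2 c2 w : R) x y :
  let Lam := symform (2 * (a1 * b2 - a2 * b1) / w) ((a1 * c2 - a2 * c1) / w)
                     (2 * (b1 * c2 - b2 * c1) / w) in
  let h1 := symform a1 b1 c1 in let h2 := symform a2 b2 c2 in
  let d := x 0 0 * y 0 1 - x 0 1 * y 0 0 in
  [/\ d * Lam x x = 2 * (h1 x x * h2 x y - h2 x x * h1 x y) / w,
      d * Lam y y = 2 * (h1 x y * h2 y y - h2 x y * h1 y y) / w
    & d * Lam x y = (h1 x x * h2 y y - h2 x x * h1 y y) / w].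
Proof.
by move=> Lam h1 h2 d; rewrite /Lam /h1 /h2 /d /symform; split; ring.
Qed.

(** [p], [q], [r] are the normal vectors h(x, x), h(x, y), h(y, y); the
    hypothesis makes [p] and [q] a basis of the normal plane, and the two
    equations say that [p + r] is parallel to both of its vectors. *)
Lemma wedges_trace0 (p1 p2 q1 q2 r1 r2 : R) :
  p1 * q2 - p2 * q1 != 0 ->
  p1 * q2 - p2 * q1 = q1 * r2 - q2 * r1 -> p1 * r2 - p2 * r1 = 0 ->
  p1 + r1 = 0 /\ p2 + r2 = 0.
Proof.
move=> d0 h1 h2.
have sq : (p1 + r1) * q2 - (p2 + r2) * q1 = 0 by lra.
split; apply: (mulfI d0); rewrite mulr0.
  transitivity (p1 * ((p1 + r1) * q2 - (p2 + r2) * q1)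
                + q1 * (p1 * r2 - p2 * r1)); first by ring.
  by rewrite sq h2 !mulr0 addr0.
transitivity (p2 * ((p1 + r1) * q2 - (p2 + r2) * q1)
              + q2 * (p1 * r2 - p2 * r1)); first by ring.
by rewrite sq h2 !mulr0 addr0.
Qed.

End Wedge.

(** * The surface at a point *)

Section Point.
Context {R : realType}.
Variables (D : set 'rV[R]_2) (z n1 n2 : 'rV[R]_2 -> 'rV[R]_4).
Hypotheses (Sz : spacelike_surface D z) (Sn : normal_frame D z n1 n2).
Implicit Types (p x y : 'rV[R]_2).

Local Notation Lam p := (symform (L z n1 n2 p) (M z n1 n2 p) (N z n1 n2 p)).
Local Notation h z n p := (symform (c11 z n p) (c12 z n p) (c22 z n p)).

Lemma minkDl (u v w : 'rV[R]_4) : mink (u + v) w = mink u w + mink v w.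
Proof.
by rewrite /mink -big_split; apply: eq_bigr => i _; rewrite !mxE /=; ring.
Qed.

Lemma minkZl (k : R) (u w : 'rV[R]_4) : mink (k *: u) w = k * mink u w.
Proof.
by rewrite /mink mulr_sumr; apply: eq_bigr => i _; rewrite !mxE; ring.
Qed.

Lemma minkC (u w : 'rV[R]_4) : mink u w = mink w u.
Proof. by apply: eq_bigr => i _; ring. Qed.

(** Pairing with [n1] and [n2] detects the normal part, because these two
    vectors are orthonormal. *)
Lemma normal_part_eq0 p (w : 'rV[R]_4) : D p ->
  normal_part n1 n2 p w = 0 <-> (mink w (n1 p) = 0 /\ mink w (n2 p) = 0).
Proof.
move=> Dp; case: Sn => _ _ /(_ p Dp) [_ [n11 n22 n12] _].
split=> [w0|[w1 w2]]; last by rewrite /normal_part w1 w2 !scale0r subrr.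
have pair n : mink w (n1 p) * mink (n1 p) n - mink w (n2 p) * mink (n2 p) n = 0.
  rewrite -!minkZl -mulN1r -minkZl scaleN1r -minkDl.
  rewrite -[X in mink X]/(normal_part _ _ _ _).
  by rewrite w0 -(scale0r 0) minkZl mul0r.
have := pair (n1 p); have := pair (n2 p).
rewrite n11 n22 n12 (minkC (n2 p)) n12 => h2 h1; split; lra.
Qed.

Lemma normal_partD p (u w : 'rV[R]_4) :
  normal_part n1 n2 p u + normal_part n1 n2 p w = normal_part n1 n2 p (u + w).
Proof. by rewrite /normal_part !minkDl !scalerDl opprD addrACA. Qed.

Lemma mean_curvature_eq0 p x y : D p ->
  mean_curvature z n1 n2 p x y = 0 <->
  (h z n1 p x x + h z n1 p y y = 0 /\ h z n2 p x x + h z n2 p y y = 0).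
Proof.
move=> Dp; rewrite /mean_curvature /sigma normal_partD.
set w := (X in normal_part _ _ _ X).
have pairE n : mink w (n p) = h z n p x x + h z n p y y.
  rewrite /w /symform /c11 /c12 /c22.
  move: (zuu z p) (zuv z p) (zvv z p) (n p) => a b c v.
  by rewrite !minkDl !minkZl; ring.
rewrite -!pairE -normal_part_eq0 //; split=> [|->]; last by rewrite scaler0.
by move/eqP; rewrite scaler_eq0 invr_eq0 pnatr_eq0 => /eqP.
Qed.

(** In an orthonormal frame, a principal frame for instance, zeta is [Lam]. *)
Lemma tangent_indicatrix_level p : D p ->
  tangent_indicatrix z n1 n2 p = [set x | Lam p x x = 1 \/ Lam p x x = -1].
Proof.
move=> Dp; have [a [b pf]] := principal_frame_exists n1 n2 Sz Dp.
rewrite (tangent_indicatrix_frame pf).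
case: pf => -[aa bb ab] [a0 pa] [b0 pb].
have := pa _ b0 ab.
rewrite /zeta aa bb sqrtr1 mulr1 divr1 => lab.
have lev X Y : indicatrix_eq z n1 n2 p a b X Y <->
    (Lam p (X *: a + Y *: b) (X *: a + Y *: b) = 1 \/
     Lam p (X *: a + Y *: b) (X *: a + Y *: b) = -1).
  rewrite symform_comb // /indicatrix_eq /normal_curvature /zeta aa bb.
  by rewrite sqrtr1 mulr1 !divr1.
apply/seteqP; split=> x /=; first by case=> X [Y [-> /lev]].
by have [X [Y ->]] := symform_span x aa bb ab => /lev; exists X, Y.
Qed.

(** The right-hand side says that [Lam] is a multiple of the first fundamental
    form.  In terms of the second fundamental form, it says that its trace is
    parallel to h(x, y) and h(x, x), which are independent at a nonflat point. *)
Lemma mean_curvature_conformal p x y :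
  D p -> ~ flat_point z n1 n2 p -> Defs.orthonormal z p x y ->
  mean_curvature z n1 n2 p x y = 0 <->
  (Lam p x x = Lam p y y /\ Lam p x y = 0).
Proof.
move=> Dp nf [xx yy xy]; rewrite mean_curvature_eq0 //.
have gram := symform_gram xx yy xy.
have gt0 : 0 < E z p * G z p - F z p ^+ 2.
  rewrite ltNge; apply/negP => le0.
  have := mulr_le0_ge0 le0 (sqr_ge0 (x 0 0 * y 0 1 - x 0 1 * y 0 0)).
  by rewrite gram ler10.
have W0 : W z p != 0 by rewrite gt_eqF // sqrtr_gt0.
have d0 : x 0 0 * y 0 1 - x 0 1 * y 0 0 != 0.
  apply/eqP => d0.
  by move: gram; rewrite d0 expr0n mulr0 => /eqP; rewrite eq_sym oner_eq0.
have [] := wedge_form_frame (c11 z n1 p) (c12 z n1 p) (c22 z n1 p)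
  (c11 z n2 p) (c12 z n2 p) (c22 z n2 p) (W z p) x y.
rewrite -/(Lam p).
move: d0; set d := _ - _ => d0.
set p1 := h z n1 p x x; set q1 := h z n1 p x y; set r1 := h z n1 p y y.
set p2 := h z n2 p x x; set q2 := h z n2 p x y; set r2 := h z n2 p y y.
move=> lxx lyy lxy.
have V0 : (W z p)^-1 != 0 by rewrite invr_eq0.
(* If h(x, x) and h(x, y) were parallel, Lam would vanish on x, hence, being a
   multiple of the first fundamental form, everywhere. *)
have pq0 : Lam p x x = Lam p y y -> Lam p x y = 0 -> p1 * q2 - p2 * q1 != 0.
  move=> exy lxy0; apply/eqP => pq; apply: nf.
  have lx0 : Lam p x x = 0 by apply: (mulfI d0); rewrite lxx pq !(mulr0, mul0r).
  apply: symform_eq0 => w.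
  by rewrite (symform_conformal w xx yy xy lx0 (etrans (esym exy) lx0) lxy0) mul0r.
split=> [[t1 t2]|[exy lxy0]].
  have r1E : r1 = - p1 by lra.
  have r2E : r2 = - p2 by lra.
  by split; apply: (mulfI d0); rewrite ?lxx ?lyy ?lxy r1E r2E; ring.
apply: (wedges_trace0 (pq0 exy lxy0)).
  have two0 : (2 : R) != 0 by rewrite pnatr_eq0.
  by apply: (mulfI two0); apply: (mulIf V0); rewrite -lxx -lyy exy.
by apply: (mulIf V0); rewrite -lxy lxy0 mulr0 mul0r.
Qed.

Lemma circle_conformal p x y :
  D p -> ~ flat_point z n1 n2 p -> Defs.orthonormal z p x y ->
  is_circle z p (tangent_indicatrix z n1 n2 p) <->
  (Lam p x x = Lam p y y /\ Lam p x y = 0).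
Proof.
move=> Dp nf [xx yy xy]; case: (Sz) => _ _ _ /(_ p) pos.
rewrite tangent_indicatrix_level //; split.
  case=> c [r [r0 circ]].
  apply: (circle_level_conformal (fun w => pos w Dp) r0 _ xx yy xy) => w.
  by move/seteqP: circ => [inS inC]; split; [exact: inS | exact: inC].
case=> exy lxy.
pose nu := Lam p x x.
have conf w : Lam p w w = nu * fst_form z p w w.
  exact: (symform_conformal w xx yy xy erefl (esym exy) lxy).
have nu0 : nu != 0.
  by apply/eqP => nu0; apply: nf; apply: symform_eq0 => w; rewrite conf nu0 mul0r.
have r0 : 0 < Num.sqrt `|nu|^-1 by rewrite sqrtr_gt0 invr_gt0 normr_gt0.
exists 0, (Num.sqrt `|nu|^-1); split=> //.
apply/seteqP; split=> w /=; rewrite subr0 conf.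
  have w0 : 0 <= fst_form z p w w.
    have [->|/(pos _ Dp)/ltW//] := eqVneq w 0.
    by rewrite /fst_form /symform !mxE !(mulr0, addr0).
  by move/(mul_eq_pm1 nu0 w0) => ->.
move/(sqrtr_eq_pos _ r0); rewrite sqr_sqrtr ?invr_ge0 // => e.
by apply/(mul_eq_pm1 nu0) => //; rewrite e invr_ge0.
Qed.

End Point.

Theorem proposition3p5 (R : realType) (D : set 'rV[R]_2)
    (z n1 n2 : 'rV[R]_2 -> 'rV[R]_4)
    (Sz : spacelike_surface D z) (Sn : normal_frame D z n1 n2)
    (not_flat : forall p, D p -> ~ flat_point z n1 n2 p) :
  minimal D z n1 n2 <->
  (forall p, D p -> is_circle z p (tangent_indicatrix z n1 n2 p)).
Proof.
split=> [mini p Dp | circ p x y Dp on].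
  have [a [b [on _ _]]] := principal_frame_exists n1 n2 Sz Dp.
  apply/(circle_conformal Sz Dp (not_flat p Dp) on).
  exact/(mean_curvature_conformal Sn Dp (not_flat p Dp) on)/mini.
apply/(mean_curvature_conformal Sn Dp (not_flat p Dp) on).
exact/(circle_conformal Sz Dp (not_flat p Dp) on)/circ.
Qed.
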